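(* If $K\subset\mathbb{R}^n$ is a nonempty closed convex set not containing the origin, then $K^\ast$ is a closed pseudo-cone.
   Context: A (convex) pseudo-cone is a nonempty convex set $K\subset\mathbb{R}^n$ not containing the origin such that $\lambda x\in K$ for all $x\in K$ and all real $\lambda\geq 1$. For a nonempty closed convex set $K\subset\mathbb{R}^n$, $K^\ast=\{x\in\mathbb{R}^n:\langle x,y\rangle\leq -1\text{ for all }y\in K\}$, where $\langle\cdot,\cdot\rangle$ is the standard inner product. *)

(* Defs.v *)
(* MathComp-Analysis *)
From HB Require Import structures.
From mathcomp Require Import all_boot all_order all_algebra.
From mathcomp Require Import all_classical all_reals all_analysis.

Set Implicit Arguments.
Unset Strict Implicit.
Unset Printing Implicit Defensive.

Import Order.TTheory GRing.Theory Num.Theory.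
Import numFieldNormedType.Exports.

Local Open Scope classical_set_scope.
Local Open Scope ring_scope.

(* R^n is 'rV[R]_n; the library topology on it, given by the sup norm, is the
   usual Euclidean topology. *)

Definition inner (R : realType) (n : nat) (x y : 'rV[R]_n) : R :=
  \sum_(i < n) x ord0 i * y ord0 i.

Definition pseudo_cone (R : realType) (n : nat) (K : set 'rV[R]_n) : Prop :=
  [/\ K !=set0,
      convex_set K,
      ~ K 0
    & forall (x : 'rV[R]_n) (lambda : R), K x -> 1 <= lambda -> K (lambda *: x)].

(* Defined for every set, although K^* is only considered for nonempty closed
   convex K. *)
Definition copolar (R : realType) (n : nat) (K : set 'rV[R]_n) : set 'rV[R]_n :=
  [set x | forall y, K y -> inner x y <= -1].

(* Main.v *)
(* The only nontrivial point is that K^* is nonempty. Let p be a point of K of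
   least Euclidean norm. Moving from p towards any y in K does not decrease the
   norm, so <p, y - p> >= 0, that is <p, y> >= <p, p> > 0 on K; hence
   - p / <p, p> belongs to K^*. *)
Require Import Defs.
From HB Require Import structures.
From mathcomp Require Import all_boot all_order all_algebra.
From mathcomp Require Import all_classical all_reals all_analysis.
From mathcomp Require Import lra.

Set Implicit Arguments.
Unset Strict Implicit.
Unset Printing Implicit Defensive.

Import Order.TTheory GRing.Theory Num.Theory.
Import numFieldNormedType.Exports.

Local Open Scope classical_set_scope.
Local Open Scope ring_scope.

Lemma innerC (R : realType) (n : nat) (x y : 'rV[R]_n) : inner x y = inner y x.
Proof. by apply: eq_bigr => i _; rewrite mulrC. Qed.

Lemma innerDl (R : realType) (n : nat) (x y z : 'rV[R]_n) :
  inner (x + y) z = inner x z + inner y z.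
Proof. by rewrite -big_split; apply: eq_bigr => i _; rewrite mxE mulrDl. Qed.

Lemma innerZl (R : realType) (n : nat) (a : R) (x z : 'rV[R]_n) :
  inner (a *: x) z = a * inner x z.
Proof. by rewrite mulr_sumr; apply: eq_bigr => i _; rewrite mxE mulrA. Qed.

Lemma innerDr (R : realType) (n : nat) (x y z : 'rV[R]_n) :
  inner z (x + y) = inner z x + inner z y.
Proof. by rewrite innerC innerDl !(innerC z). Qed.

Lemma innerZr (R : realType) (n : nat) (a : R) (x z : 'rV[R]_n) :
  inner z (a *: x) = a * inner z x.
Proof. by rewrite innerC innerZl innerC. Qed.

Lemma inner_ge0 (R : realType) (n : nat) (x : 'rV[R]_n) : 0 <= inner x x.
Proof. by apply: sumr_ge0 => i _; rewrite -expr2 sqr_ge0. Qed.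

Lemma inner_gt0 (R : realType) (n : nat) (x : 'rV[R]_n) :
  x != 0 -> 0 < inner x x.
Proof.
rewrite lt_def inner_ge0 andbT; apply: contra => /eqP x0.
apply/eqP/rowP => i; rewrite mxE; apply/eqP; rewrite -sqrf_eq0 expr2.
by move/psumr_eq0P: x0 => -> // j _; rewrite -expr2 sqr_ge0.
Qed.

(** Makes sublevel sets of the squared norm bounded coordinatewise. *)
Lemma sqr_coord_le_inner (R : realType) (n : nat) (x : 'rV[R]_n) (i : 'I_n) :
  x ord0 i ^+ 2 <= inner x x.
Proof.
rewrite /inner (bigD1 i) //= -expr2 lerDl.
by apply: sumr_ge0 => j _; rewrite -expr2 sqr_ge0.
Qed.

(** Two varying arguments cover both the squared norm and the pairing with a fixed vector. *)
Lemma continuous_inner (R : realType) (n : nat) (T : topologicalType)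
    (f g : T -> 'rV[R]_n) :
  continuous f -> continuous g -> continuous (fun z => inner (f z) (g z)).
Proof.
move=> cf cg; apply: continuous_big => [|i _ z]; first exact: add_continuous.
apply: cvgM.
- exact: continuous_comp (cf z) (@coord_continuous _ _ _ _ _ _).
- exact: continuous_comp (cg z) (@coord_continuous _ _ _ _ _ _).
Qed.

Lemma convex_set_segment (R : realType) (E : lmodType R) (A : set E) (x y : E)
    (t : R) :
  convex_set A -> A x -> A y -> 0 <= t -> t <= 1 -> A (x + t *: (y - x)).
Proof.
move=> cA Ax Ay t0 t1.
(* [conv] puts the weight [t] on its first point, so [y] comes first. *)
have /set_mem := cA y x (Itv01 t0 t1) (mem_set Ay) (mem_set Ax).
rewrite /conv /= /unstable.onem scalerBl scale1r scalerBr.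
by congr A; rewrite addrCA.
Qed.

(** For any [k] in [K], the part of [K] where the squared norm is at most that of [k] is compact. A
    minimizer there is global, since the rest of [K] has larger norm. *)
Lemma exists_min_inner (R : realType) (n : nat) (K : set 'rV[R]_n) :
  K !=set0 -> closed K ->
  exists2 p, K p & forall y, K y -> inner p p <= inner y y.
Proof.
move=> [k Kk] Kcl.
have cN : continuous (fun z : 'rV[R]_n => inner z z).
  by apply: continuous_inner => z.
pose c := inner k k.
pose S := K `&` [set z | inner z z <= c].
have Scl : closed S.
  apply: closedI => //.
  by apply: (@preimage_closed _ _ (fun z : 'rV[R]_n => inner z z)
    [set r | r <= c]) => [z _|]; [exact: cN | exact: closed_le].
have Scpt : compact S.
  (* Each coordinate has square at most [c], and [c <= (1 + c) ^ 2], so the box of half-width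
     [1 + c] contains [S] and no square root is taken. *)
  apply: (subclosed_compact Scl
    (@rV_compact _ n (fun=> `[- (1 + c), 1 + c]%classic) _)).
    by move=> _; exact: segment_compact.
  move=> z [_ /= zc] i; rewrite /= in_itv /=.
  have := sqr_coord_le_inner z i; have := inner_ge0 z.
  by move=> ? ?; apply/andP; split; nra.
have [|p /set_mem[Kp pc] pmin] := compact_EVT_min _ Scpt (continuous_subspaceT cN).
  by exists k; split => //=.
exists p => // y Ky; have [yc|/ltW cy] := leP (inner y y) c.
  by apply: pmin; apply/mem_set; split.
exact: le_trans pc cy.
Qed.

(** First-order condition at [p]: if [a < 0], a short step from [p] towards [y] stays in [K] and
    strictly lowers the squared norm. *)
Lemma min_inner_variational (R : realType) (n : nat) (K : set 'rV[R]_n)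
    (p y : 'rV[R]_n) :
  convex_set K -> K p -> (forall z, K z -> inner p p <= inner z z) -> K y ->
  inner p p <= inner p y.
Proof.
move=> cK Kp pmin Ky.
pose a := inner p (y - p); pose b := inner (y - p) (y - p).
have b0 : 0 <= b by exact: inner_ge0.
suff a0 : 0 <= a.
  by rewrite -(subrK p y) innerDr -/a lerDr.
rewrite leNgt; apply/negP => a0.
have ba : 0 < b - a by lra.
(* A step at which the quadratic [2 t a + t^2 b] is negative, also if [b = 0]. *)
pose t := - a / (b - a).
have tba : t * (b - a) = - a by rewrite divfK // gt_eqF.
have t0 : 0 < t by rewrite divr_gt0 // oppr_gt0.
have t1 : t <= 1 by rewrite ler_pdivrMr //; lra.
have := pmin _ (convex_set_segment cK Kp Ky (ltW t0) t1).
rewrite innerDl !innerDr !innerZl !innerZr (innerC (y - p) p) -/a -/b.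
(* By the choice of [t], [2 t a + t^2 b = t a (1 + t)], which is negative, whereas minimality makes
   it nonnegative. *)
by nra.
Qed.

(** An intersection of closed half-spaces, one for each point of [K]. *)
Lemma closed_copolar (R : realType) (n : nat) (K : set 'rV[R]_n) :
  closed (copolar K).
Proof.
have -> : copolar K =
    \bigcap_(y in K) ((fun x => inner x y) @^-1` [set r | r <= -1]) by [].
apply: closed_bigI => y _; apply: preimage_closed => [x _|]; last exact: closed_le.
exact: continuous_inner (fun=> cvg_id) (@cst_continuous _ _ y) x.
Qed.

Lemma convex_copolar (R : realType) (n : nat) (K : set 'rV[R]_n) :
  convex_set (copolar K).
Proof.
move=> x z l /set_mem Kx /set_mem Kz; apply/mem_set => y Ky.
rewrite /conv /= innerDl !innerZl /unstable.onem.
have l0 : 0 <= l%:num by [].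
have l1 : l%:num <= 1 by [].
have xy := Kx y Ky; have zy := Kz y Ky.
by nra.
Qed.

Theorem lemma3p7 (R : realType) (n : nat) (K : set 'rV[R]_n)
    (K_nonempty : K !=set0) (K_closed : closed K) (K_convex : convex_set K)
    (K_origin : ~ K 0) :
  closed (copolar K) /\ pseudo_cone (copolar K).
Proof.
split; first exact: closed_copolar.
split; last 1 first.
- move=> x l Kx l1 y Ky; rewrite innerZl; have := Kx y Ky.
  by nra.
- have [p Kp pmin] := exists_min_inner K_nonempty K_closed.
  have p0 : 0 < inner p p.
    by apply: inner_gt0; apply/eqP => p0; apply: K_origin; rewrite -p0.
  exists (- (inner p p)^-1 *: p) => y Ky.
  rewrite innerZl mulNr lerN2 mulrC ler_pdivlMr // mul1r.
  exact: min_inner_variational K_convex Kp pmin Ky.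
- exact: convex_copolar.
(* If the origin belonged to [copolar K], pairing it with [k] would give [0 <= -1]. *)
- have [k Kk] := K_nonempty => /(_ k Kk).
  by rewrite -(scale0r 0) innerZl mul0r => ?; lra.
Qed.
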